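(* Let $K\subseteq R$ and $K'\subseteq R'$ be (not necessarily commutative) subfields of rings $R,R'$, let $\alpha:R\to R'$ be a Jordan homomorphism, let $R''$ be the subring of $R'$ generated by $R^\alpha$, and let $\overline\alpha:C\to C''$ be the (well defined) mapping $R(1,0)\cdot E(T)\mapsto R'(1',0')\cdot E(T^\alpha)$ for finite sequences $T$ in $R$. Then $\overline\alpha$ maps every $K$-chain contained in $C$ into a $K'$-chain if and only if for each $c\in R^*$ there is a $u'_c\in R'^*$ such that $(Kc)^\alpha\subseteq ({u'_c}^{-1}K'u'_c)\,c^\alpha$.
   Context: Rings are associative with $1$, subfields contain $1$. A Jordan homomorphism $\alpha:R\to R'$ satisfies $(a+b)^\alpha=a^\alpha+b^\alpha$, $1^\alpha=1'$, $(aba)^\alpha=a^\alpha b^\alpha a^\alpha$. For $t$ in a ring, $E(t):=\begin{pmatrix} t&1\\-1&0\end{pmatrix}$; $E(T):=E(t_1)\cdots E(t_n)$ for $T=(t_1,\ldots,t_n)$ ($=I$ if $n=0$), $T^\alpha:=(t_1^\alpha,\ldots,t_n^\alpha)$. The projective line $\mathbb{P}(R)$ is the set of submodules $R(a,b)\leq R^2$ with $(a,b)$ the first row of a matrix in $GL_2(R)$, with right action $R(a,b)\cdot M=R((a,b)M)$. Points are distant if representatives form a basis of $R^2$. $C$ is the connected component of $R(1,0)$ in the distant graph of $\mathbb{P}(R)$; $\mathbb{P}(R'')$ is identified with a subset of $\mathbb{P}(R')$ via $R''(a,b)\mapsto R'(a,b)$ and $C''$ is the connected component of $R''(1',0')$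 in $\mathbb{P}(R'')$. The projective line $\mathbb{P}(K)$ is identified with the subset $\{R(a,b)\mid (a,b)\in K^2\setminus\{(0,0)\}\}$ of $\mathbb{P}(R)$; the $K$-chains are the images of this set under $GL_2(R)$ (chain geometry $\Sigma(K,R)$). $K'$-chains in $\mathbb{P}(R')$ are defined analogously. *)

(* Defs.v *)
From HB Require Import structures.
From mathcomp Require Import all_boot all_order all_algebra.
From Stdlib Require Import Relations.Relation_Operators.

Set Implicit Arguments.
Unset Strict Implicit.
Unset Printing Implicit Defensive.

Import GRing.Theory.
Local Open Scope ring_scope.

Definition subfield (R : nzRingType) (K : R -> Prop) : Prop :=
  [/\ K 0, K 1,
      (forall x y, K x -> K y -> K (x - y)),
      (forall x y, K x -> K y -> K (x * y)) &
      (forall x, K x -> x <> 0 -> exists2 y, K y & x * y = 1 /\ y * x = 1)].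

Definition is_unit (R : nzRingType) (c : R) : Prop :=
  exists d : R, c * d = 1 /\ d * c = 1.

Definition jordan_hom (R R' : nzRingType) (f : R -> R') : Prop :=
  [/\ (forall a b, f (a + b) = f a + f b),
      f 1 = 1 &
      (forall a b, f (a * b * a) = f a * f b * f a)].

Definition rv (R : nzRingType) (a b : R) : 'rV[R]_2 :=
  \row_(j < 2) if j == 0 then a else b.

Definition Emat (R : nzRingType) (t : R) : 'M[R]_2 :=
  \matrix_(i < 2, j < 2)
     if i == 0 then (if j == 0 then t else 1) else (if j == 0 then -1 else 0).

Definition Eseq (R : nzRingType) (T : seq R) : 'M[R]_2 :=
  foldr (fun t M => Emat t *m M) 1%:M T.

Definition inv2 (R : nzRingType) (M : 'M[R]_2) : Prop :=
  exists N : 'M[R]_2, M *m N = 1%:M /\ N *m M = 1%:M.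

(* A point of P(R) is the cyclic left submodule R v of R^2 *)
Definition point (R : nzRingType) := 'rV[R]_2 -> Prop.

Definition pt (R : nzRingType) (v : 'rV[R]_2) : point R :=
  fun w => exists r : R, w = r *: v.

Definition basis2 (R : nzRingType) (v w : 'rV[R]_2) : Prop :=
  forall x : 'rV[R]_2, exists r s : R,
    x = r *: v + s *: w /\
    forall r' s' : R, x = r' *: v + s' *: w -> r' = r /\ s' = s.

Definition distant (R : nzRingType) (p q : point R) : Prop :=
  exists v w : 'rV[R]_2, p = pt v /\ q = pt w /\ basis2 v w.

Definition Ccomp (R : nzRingType) (p : point R) : Prop :=
  clos_refl_trans (point R) (@distant R) (pt (rv 1 0)) p.

(* K-chains: images of P(K) = {R(a,b) | (a,b) in K^2 \ {(0,0)}} under GL_2(R) *)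
Definition Kchain (R : nzRingType) (K : R -> Prop) (G : point R -> Prop) : Prop :=
  exists M : 'M[R]_2, inv2 M /\
    forall p : point R,
      G p <-> exists a b : R, [/\ K a, K b, (a, b) <> (0, 0) & p = pt (rv a b *m M)].

(* Main.v *)
(** Let [M = E(T)] with inverse [N], and let [M'], [N'] be the same matrices for
    [T^alpha].  The entries of [M] are not preserved by the Jordan homomorphism
    [alpha], but sandwiches such as [M11 x N00] and [N00 x M11], and also the
    product [N00 M01], are sums of Jordan monomials, hence preserved.  If [E(T)]
    fixes [R(1,0)], then [M01 = 0] and [N00], [M11] are units; so [N'00] is a
    unit and [N'00 M'01 = 0], i.e. [E(T^alpha)] fixes [R'(1,0)].  This is the
    well-definedness of the induced map on points.

    The chain [P(K) diag(1,c)] contains [R(1,0)], [R(0,1)] and all [R(1,kc)];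
    moving the first two points of its image to normal position by [GL_2(K')]
    yields the condition on [(Kc)^alpha].  Conversely a chain in [C] has, besides
    [R(1,0) E(T0)], the points [R(1,0) E(y^-1 k u + t) E(T0)] with [u], [y]
    units, and [y^-1 k u = y^-1 (k (u y)) y^-1] is a Jordan product to which the
    condition with [c = u y] applies. *)

Require Import Defs.
From HB Require Import structures.
From mathcomp Require Import all_boot all_order all_algebra.
From Stdlib Require Import Relation_Operators Operators_Properties.
From Stdlib Require Import FunctionalExtensionality PropExtensionality.
Import GRing.Theory.
Local Open Scope ring_scope.

Set Implicit Arguments.
Unset Strict Implicit.
Unset Printing Implicit Defensive.

(** * Row vectors, points and bases of [R^2] *)

Section RowVectors.
Variable R : nzRingType.
Implicit Types (a b c d r s t : R) (v w z e x : 'rV[R]_2) (M N : 'M[R]_2).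

Lemma rvE0 a b : rv a b 0 0 = a. Proof. by rewrite mxE. Qed.
Lemma rvE1 a b : rv a b 0 1 = b. Proof. by rewrite mxE. Qed.

Lemma row2P v w : v 0 0 = w 0 0 -> v 0 1 = w 0 1 -> v = w.
Proof.
move=> h0 h1; apply/matrixP=> i j; rewrite (ord1 i).
by case: j => [[|[|//]]] lj; [move: h0 | move: h1];
  congr (v _ _ = w _ _); apply: val_inj.
Qed.

Lemma mulmx2E (m n : nat) (A : 'M[R]_(m, 2)) (B : 'M[R]_(2, n)) i j :
  (A *m B) i j = A i 0 * B 0 j + A i 1 * B 1 j.
Proof.
rewrite mxE !big_ord_recl big_ord0 addr0; congr (_ + A i _ * B _ j);
  exact: val_inj.
Qed.

Lemma rv_eta v : v = rv (v 0 0) (v 0 1).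
Proof. by apply: row2P; rewrite ?rvE0 ?rvE1. Qed.

Lemma rvD a b c d : rv a b + rv c d = rv (a + c) (b + d).
Proof. by apply: row2P; rewrite !mxE. Qed.

Lemma rvZ r a b : r *: rv a b = rv (r * a) (r * b).
Proof. by apply: row2P; rewrite !mxE. Qed.

Lemma rv_inj a b c d : rv a b = rv c d -> a = c /\ b = d.
Proof.
by move=> h; split; [rewrite -(rvE0 a b) h rvE0 | rewrite -(rvE1 a b) h rvE1].
Qed.

Lemma rv_span a b : rv a b = a *: rv 1 0 + b *: rv 0 1.
Proof. by rewrite !rvZ rvD !mulr1 !mulr0 addr0 add0r. Qed.

Lemma rv_mulmx a b M :
  rv a b *m M = a *: (rv 1 0 *m M) + b *: (rv 0 1 *m M).
Proof. by rewrite rv_span mulmxDl -!scalemxAl. Qed.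

Lemma rv10_mulmx M : rv 1 0 *m M = rv (M 0 0) (M 0 1).
Proof. by apply: row2P; rewrite mulmx2E ?rvE0 ?rvE1 mul1r mul0r addr0. Qed.

Lemma rv01_mulmx M : rv 0 1 *m M = rv (M 1 0) (M 1 1).
Proof. by apply: row2P; rewrite mulmx2E ?rvE0 ?rvE1 mul1r mul0r add0r. Qed.

Lemma mx2P M N : rv 1 0 *m M = rv 1 0 *m N -> rv 0 1 *m M = rv 0 1 *m N -> M = N.
Proof.
rewrite !rv10_mulmx !rv01_mulmx => /rv_inj[h00 h01] /rv_inj[h10 h11].
apply/matrixP; case=> [[|[|//]]] li; case=> [[|[|//]]] lj;
 [move: h00 | move: h01 | move: h10 | move: h11];
 by congr (M _ _ = N _ _); apply: val_inj.
Qed.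

Lemma pt_self v : pt v v.
Proof. by exists 1; rewrite scale1r. Qed.

Lemma pt_ext (p q : point R) : (forall w, p w <-> q w) -> p = q.
Proof.
by move=> h; apply: functional_extensionality => w; apply: propositional_extensionality.
Qed.

Lemma pt_unit c d v : d * c = 1 -> pt (c *: v) = pt v.
Proof.
move=> dc; apply: pt_ext => w; split=> -[r ->].
  by exists (r * c); rewrite scalerA.
by exists (r * d); rewrite scalerA -mulrA dc mulr1.
Qed.

Lemma pt_eq_scale v w : pt v = pt w -> exists r, v = r *: w.
Proof. by move=> h; move: (pt_self v); rewrite h. Qed.

Lemma pt_mulmx v w M : pt v = pt w -> pt (v *m M) = pt (w *m M).
Proof.
move=> h; have [r hr] := pt_eq_scale h; have [s hs] := pt_eq_scale (esym h).
apply: pt_ext => x; split=> -[k ->].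
  by exists (k * r); rewrite {1}hr -scalemxAl scalerA.
by exists (k * s); rewrite {1}hs -scalemxAl scalerA.
Qed.

Lemma basis2_indep v w a b c d : basis2 v w ->
  a *: v + b *: w = c *: v + d *: w -> a = c /\ b = d.
Proof.
move=> /(_ (a *: v + b *: w))[r [s [_ u]]] h.
by have [-> ->] := u a b erefl; have [-> ->] := u c d h.
Qed.

Lemma basis2_rv : basis2 (rv 1 0 : 'rV[R]_2) (rv 0 1).
Proof.
move=> x; exists (x 0 0), (x 0 1); split; first by rewrite -rv_span -rv_eta.
by move=> r s; rewrite -rv_span => ->; rewrite rvE0 rvE1.
Qed.

Lemma basis2_mulmx v w M : inv2 M -> basis2 v w -> basis2 (v *m M) (w *m M).
Proof.
move=> [N [MN NM]] bvw x; have [r [s [h u]]] := bvw (x *m N).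
exists r, s; split.
  by rewrite !scalemxAl -mulmxDl -h -mulmxA NM mulmx1.
move=> r' s'; rewrite !scalemxAl -mulmxDl => h'; apply: u.
by rewrite h' -mulmxA MN mulmx1.
Qed.

Lemma basis2_rows M : inv2 M -> basis2 (rv 1 0 *m M) (rv 0 1 *m M).
Proof. by move=> iM; apply: basis2_mulmx iM basis2_rv. Qed.

(* Two bases whose first vectors span the same point differ by a lower
   triangular matrix with invertible diagonal. *)
Lemma basis2_pt_eq v w z e : basis2 v w -> basis2 z e -> pt v = pt z ->
  exists u s x y b : R, [/\ v = u *: z, u * s = 1 /\ s * u = 1,
    w = x *: z + y *: e, y * b = 1 & b * y = 1].
Proof.
move=> bvw bze pvz.
have [u hu] := pt_eq_scale pvz; have [s hs] := pt_eq_scale (esym pvz).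
have [x [y [hw _]]] := bze w; have [a [b [he _]]] := bvw e.
exists u, s, x, y, b; split=> //.
- split.
    have [|//] := @basis2_indep v w (u * s) 0 1 0 bvw _.
    by rewrite -scalerA -hs -hu scale1r.
  have [|//] := @basis2_indep z e (s * u) 0 1 0 bze _.
  by rewrite -scalerA -hu -hs scale1r.
- have [|//] := @basis2_indep v w (x * s + y * a) (y * b) 0 1 bvw _.
  rewrite scalerDl -!scalerA -hs -addrA -scalerDr -he -hw.
  by rewrite scale0r scale1r add0r.
- have [|//] := @basis2_indep z e (a * u + b * x) (b * y) 0 1 bze _.
  rewrite scalerDl -!scalerA -hu -addrA -scalerDr -hw -he.
  by rewrite scale0r scale1r add0r.
Qed.

Lemma inv2_mulmx M N : inv2 M -> inv2 N -> inv2 (M *m N).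
Proof.
move=> [M1 [h1 h2]] [N1 [h3 h4]]; exists (N1 *m M1); split.
  by rewrite mulmxA -(mulmxA M) h3 mulmx1.
by rewrite mulmxA -(mulmxA N1) h2 mulmx1.
Qed.

Definition mx_rows v w : 'M[R]_2 :=
  \matrix_(i < 2, j < 2) if i == 0 then v 0 j else w 0 j.

Lemma rv10_mx_rows v w : rv 1 0 *m mx_rows v w = v.
Proof. by rewrite rv10_mulmx !mxE -rv_eta. Qed.

Lemma rv01_mx_rows v w : rv 0 1 *m mx_rows v w = w.
Proof. by rewrite rv01_mulmx !mxE -rv_eta. Qed.

Lemma inv2_trig a a1 (x : R) d d1 : a * a1 = 1 -> a1 * a = 1 -> d * d1 = 1 ->
  d1 * d = 1 -> inv2 (mx_rows (rv a 0) (rv x d)).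
Proof.
move=> h1 h2 h3 h4; exists (mx_rows (rv a1 0) (rv (- (d1 * x * a1)) d1)).
split; apply: mx2P; rewrite mulmx1 mulmxA ?rv10_mx_rows ?rv01_mx_rows;
  rewrite rv_mulmx rv10_mx_rows rv01_mx_rows !rvZ rvD.
- by rewrite h1 mulr0 !mul0r !addr0.
- by rewrite h3 mulr0 add0r mulrN !mulrA h3 mul1r subrr.
- by rewrite h2 mulr0 !mul0r !addr0.
- by rewrite h4 mulr0 add0r mulNr -!mulrA h2 mulr1 addNr.
Qed.

End RowVectors.

(** * Products of the matrices [E(t)] and the connected component of [R(1,0)] *)

Section ElementaryProducts.
Variable R : nzRingType.
Implicit Types (t : R) (S T : seq R).

(* [E(t)^-1 = E(0) E(-t) E(0)], so the inverse of [E(T)] is again some [E(S)]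
   with [S] built from [T] additively. *)
Definition Einv t : 'M[R]_2 := Emat 0 *m Emat (- t) *m Emat 0.

Definition inv_seq T : seq R := foldr (fun t S => S ++ [:: 0; - t; 0]) [::] T.

Lemma rv_Emat t (a b : R) : rv a b *m Emat t = rv (a * t - b) a.
Proof.
by apply: row2P; rewrite mulmx2E ?rvE0 ?rvE1 !mxE /= ?mulrN1 ?mulr1 ?mulr0 ?addr0.
Qed.

Lemma rv_Einv t (a b : R) : rv a b *m Einv t = rv b (b * t - a).
Proof.
rewrite !mulmxA !rv_Emat !mulr0 !sub0r; congr rv; first by rewrite opprK.
by rewrite mulrN mulNr opprK addrC.
Qed.

Lemma Emat_mulE t (M : 'M[R]_2) j :
  (Emat t *m M) 0 j = t * M 0 j + M 1 j /\ (Emat t *m M) 1 j = - M 0 j.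
Proof. by split; rewrite mulmx2E !mxE /= ?mul1r ?mulN1r ?mul0r ?addr0. Qed.

Lemma mul_EinvE t (M : 'M[R]_2) i :
  (M *m Einv t) i 0 = M i 1 /\ (M *m Einv t) i 1 = M i 1 * t - M i 0.
Proof.
have h : row i (M *m Einv t) = rv (M i 1) (M i 1 * t - M i 0).
  by rewrite row_mul [row i M]rv_eta !mxE rv_Einv.
by split; [rewrite -[RHS](rvE0 _ (M i 1 * t - M i 0)) | rewrite -[RHS](rvE1 (M i 1))];
  rewrite -h [RHS]mxE.
Qed.

Lemma Emat_inv t : Emat t *m Einv t = 1%:M.
Proof.
apply: mx2P; rewrite mulmx1 mulmxA rv_Emat rv_Einv; congr rv;
  by rewrite ?mul1r ?mul0r ?opprB ?opprK ?add0r ?subr0 ?subrr // addrC subrK.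
Qed.

Lemma Einv_mul t : Einv t *m Emat t = 1%:M.
Proof.
apply: mx2P; rewrite mulmx1 mulmxA rv_Einv rv_Emat; congr rv;
  by rewrite ?mul1r ?mul0r ?opprB ?opprK ?add0r ?subr0 ?subrr // addrC subrK.
Qed.

Lemma Eseq_cat S T : Eseq (S ++ T) = Eseq S *m Eseq T.
Proof. by elim: S => [|s S IH] /=; rewrite ?mul1mx // IH mulmxA. Qed.

Lemma Eseq_inv_cons t T : Eseq (inv_seq (t :: T)) = Eseq (inv_seq T) *m Einv t.
Proof. by rewrite /= Eseq_cat /= mulmx1 /Einv !mulmxA. Qed.

Lemma Eseq_invr T : Eseq T *m Eseq (inv_seq T) = 1%:M.
Proof.
elim: T => [|t T IH]; first by rewrite mulmx1.
by rewrite Eseq_inv_cons mulmxA -(mulmxA (Emat t)) IH mulmx1 Emat_inv.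
Qed.

Lemma Eseq_invl T : Eseq (inv_seq T) *m Eseq T = 1%:M.
Proof.
elim: T => [|t T IH]; first by rewrite mulmx1.
by rewrite Eseq_inv_cons mulmxA -(mulmxA _ (Einv t)) Einv_mul mulmx1 IH.
Qed.

Lemma Eseq_inv2 T : inv2 (Eseq T).
Proof. by exists (Eseq (inv_seq T)); rewrite Eseq_invr Eseq_invl. Qed.

Lemma Eseq_inv_seqK T : Eseq (inv_seq (inv_seq T)) = Eseq T.
Proof. by rewrite -[LHS]mul1mx -(Eseq_invr T) -mulmxA Eseq_invr mulmx1. Qed.

Lemma rv10_Eseq_cons t T :
  rv 1 0 *m Eseq (t :: T) = t *: (rv 1 0 *m Eseq T) + rv 0 1 *m Eseq T.
Proof. by rewrite mulmxA rv_Emat mul1r subr0 rv_mulmx scale1r. Qed.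

(** Induction along a path, extended at its far end. In the basis given by the rows of [E(T)] the
    next point is generated by some [(x, y)] with [y] a unit, and dividing by [y] prepends [y^-1 x]
    to [T]. *)
Lemma Ccomp_Eseq (p : point R) :
  Ccomp p -> exists T, p = pt (rv 1 0 *m Eseq T).
Proof.
move=> h; elim: (clos_rt_rtn1 _ _ _ _ h) => [|q r [v [w [-> [-> bvw]]]] _ [T hT]].
  by exists [::]; rewrite mulmx1.
have [u [s [x [y [b [_ _ hw yb yb']]]]]] :=
  basis2_pt_eq bvw (basis2_rows (Eseq_inv2 T)) hT.
exists (b * x :: T); rewrite rv10_Eseq_cons -(pt_unit w yb); congr pt.
by rewrite hw scalerDr !scalerA yb' scale1r.
Qed.

(** A Jordan homomorphism acts on this sequence entrywise, so the induced map sends [R(1,t)] to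
    [R'(1,f t)]. *)
Lemma pt_1_Eseq t : pt (rv 1 t) = pt (rv 1 0 *m Eseq [:: - t; 0]).
Proof.
rewrite /= mulmx1 mulmxA !rv_Emat mulr0 sub0r mul1r subr0.
by rewrite -[in RHS](@pt_unit _ (-1) (-1)) ?rvZ ?mulN1r ?opprK.
Qed.

Lemma pt_0_Eseq : pt (rv 0 1) = pt (rv 1 0 *m Eseq [:: 0 : R]).
Proof. by rewrite /= mulmx1 rv_Emat mulr0 subr0. Qed.

Lemma Ccomp_01 : Ccomp (pt (rv (0 : R) 1)).
Proof.
by apply: rt_step; exists (rv 1 0), (rv 0 1); do !split; apply: basis2_rv.
Qed.

Lemma Ccomp_1 t : Ccomp (pt (rv 1 t)).
Proof.
apply: rt_trans Ccomp_01 _; apply: rt_step.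
exists (rv 0 1), (rv 1 t); do !split.
move=> x; exists (x 0 1 - x 0 0 * t), (x 0 0); split.
  by rewrite !rvZ rvD !mulr1 !mulr0 add0r subrK -rv_eta.
move=> r s ->; rewrite !rvZ rvD rvE0 rvE1 !mulr1 mulr0 add0r.
by rewrite addrK.
Qed.

End ElementaryProducts.

(** * Jordan homomorphisms on entries of [E(T)]; the induced map is well defined *)

Lemma addr_mul_sandwich (A : nzRingType) (a b c : A) :
  (a + c) * b * (a + c) = a * b * a + (a * b * c + c * b * a) + c * b * c.
Proof. by rewrite !mulrDl !mulrDr !addrA. Qed.

Section JordanHomomorphisms.
Variables (R R' : nzRingType) (f : R -> R') (jf : jordan_hom f).
Implicit Types (a b c s t x y p q : R) (S T : seq R).

Let fD a b : f (a + b) = f a + f b. Proof. by case: jf. Qed.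
Let f1 : f 1 = 1. Proof. by case: jf. Qed.
Let fU a b : f (a * b * a) = f a * f b * f a. Proof. by case: jf. Qed.

Lemma jordan0 : f 0 = 0.
Proof. by apply: (addrI (f 0)); rewrite -fD !addr0. Qed.

Lemma jordanN a : f (- a) = - f a.
Proof. by apply: (addrI (f a)); rewrite -fD !subrr jordan0. Qed.

(** Polarization of the identity for [a * b * a] at [a + c]. *)
Lemma jordan_triple a b c :
  f (a * b * c + c * b * a) = f a * f b * f c + f c * f b * f a.
Proof.
have := fU (a + c) b; rewrite addr_mul_sandwich fD addr_mul_sandwich 2!fD !fU.
by move=> /addIr /addrI.
Qed.

(** Applying [f] to [a * (b * b) * a = 1] shows that [f a] is invertible from both sides, so it
    cancels in [f a * f b * f a = f a]. *)
Lemma jordan_inv a b : a * b = 1 -> b * a = 1 -> f a * f b = 1 /\ f b * f a = 1.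
Proof.
move=> ab ba.
have sqb : f (b * b) = f b * f b by have := fU b 1; rewrite f1 !mulr1.
have hu : f a * (f b * f b) * f a = 1 by rewrite -sqb -fU mulrA ab mul1r ba f1.
have ha : f a * f b * f a = f a by rewrite -fU ab mul1r.
split.
  by rewrite -[LHS]mulr1 -hu !mulrA ha.
by rewrite -[LHS]mul1r -hu -!mulrA (mulrA (f a) (f b) (f a)) ha !mulrA.
Qed.

(* The 2x2 matrix [(p, q)^T x (p_, q_)] is made of products of the shape
   [t1 ... tn x tn ... t1]; the four conditions say that [f] respects its
   "hermitian" part, which is what makes them stable under [E(t)]. *)
Definition jordan_pair p q p_ q_ (p' q' p_' q_' : R') : Prop :=
  [/\ forall x, f (p * x * p_) = p' * f x * p_',
      forall x, f (q * x * q_) = q' * f x * q_',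
      forall s x, f (s * p * x * q_ + q * x * p_ * s) =
                  f s * p' * f x * q_' + q' * f x * p_' * f s &
      forall s x, f (s * q * x * p_ + p * x * q_ * s) =
                  f s * q' * f x * p_' + p' * f x * q_' * f s].

(** Each new expression regroups into an old one plus Jordan products or triples of [s], [t] and
    [p * x * p_], all of which [f] respects. *)
Lemma jordan_pair_cons t p q p_ q_ (p' q' p_' q_' : R') :
  jordan_pair p q p_ q_ p' q' p_' q_' ->
  jordan_pair (t * p + q) (- p) (p_ * t + q_) (- p_)
              (f t * p' + q') (- p') (p_' * f t + q_') (- p_').
Proof.
have EA : forall (A : nzRingType) (t p q p_ q_ x : A),
    (t * p + q) * x * (p_ * t + q_) =
    t * (p * x * p_) * t + (t * p * x * q_ + q * x * p_ * t) + q * x * q_.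
  by move=> *; rewrite !mulrDl !mulrDr !mulrA !addrA; congr (_ + _); rewrite addrAC.
have EN : forall (A : nzRingType) (p p_ x : A), - p * x * - p_ = p * x * p_.
  by move=> *; rewrite mulrN !mulNr opprK.
have EB : forall (A : nzRingType) (s t p q p_ q_ x : A),
    s * (t * p + q) * x * - p_ + - p * x * (p_ * t + q_) * s =
    - (s * t * (p * x * p_) + p * x * p_ * t * s)
    - (s * q * x * p_ + p * x * q_ * s).
  by move=> *; rewrite mulrN !mulNr !mulrDr !mulrDl !mulrA -opprD -opprD addrACA.
have EC : forall (A : nzRingType) (s t p q p_ q_ x : A),
    s * - p * x * (p_ * t + q_) + (t * p + q) * x * - p_ * s =
    - (s * (p * x * p_) * t + t * (p * x * p_) * s)
    - (s * p * x * q_ + q * x * p_ * s).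
  by move=> *; rewrite !mulrN !mulNr !mulrDr !mulrDl !mulrA -opprD -opprD addrACA.
move=> [hp hq hpq hqp]; split=> [x|x|s x|s x].
- by rewrite !EA !fD fU hp hq -fD hpq.
- by rewrite !EN hp.
- rewrite !EB fD !jordanN hqp -hp; congr (- _ - _).
  by rewrite -jordan_triple.
- by rewrite !EC fD !jordanN hpq jordan_triple -hp.
Qed.

Lemma map_inv_seq T : map f (inv_seq T) = inv_seq (map f T).
Proof. by elim: T => //= t T <-; rewrite map_cat /= jordan0 jordanN. Qed.

(** A row of the inverse enters rotated, as [(N i 1, - N i 0)] up to sign: in this form right
    multiplication by [Einv t] acts by [(p_, q_) |-> (p_ * t + q_, - p_)]. *)
Lemma jordan_pair_Eseq T :
  let M := Eseq T in let N := Eseq (inv_seq T) in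
  let M' := Eseq (map f T) in let N' := Eseq (inv_seq (map f T)) in
  jordan_pair (M 0 0) (M 1 0) (N 1 1) (- N 1 0)
              (M' 0 0) (M' 1 0) (N' 1 1) (- N' 1 0) /\
  jordan_pair (M 0 1) (M 1 1) (- N 0 1) (N 0 0)
              (M' 0 1) (M' 1 1) (- N' 0 1) (N' 0 0).
Proof.
elim: T => [|t T [IH1 IH2]].
  rewrite /= !mxE /=; split; split=> *;
  by rewrite ?(oppr0, mulr0, mul0r, mulr1, mul1r, addr0, add0r, jordan0).
rewrite map_cons !Eseq_inv_cons /=.
rewrite !(Emat_mulE _ _ _).1 !(Emat_mulE _ _ _).2 !(mul_EinvE _ _ _).1 !(mul_EinvE _ _ _).2.
split.
  exact: jordan_pair_cons IH1.
have := jordan_pair_cons t IH2.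
by rewrite !opprK !mulNr !opprB ![_ 0 0 - _]addrC.
Qed.

Lemma jordan_Eseq_sandwich T x :
  let M := Eseq T in let N := Eseq (inv_seq T) in
  let M' := Eseq (map f T) in let N' := Eseq (inv_seq (map f T)) in
  [/\ f (M 1 1 * x * N 0 0) = M' 1 1 * f x * N' 0 0,
      f (N 0 0 * x * M 1 1) = N' 0 0 * f x * M' 1 1 &
      f (N 0 1 * x * M 0 1) = N' 0 1 * f x * M' 0 1].
Proof.
have [_ [_ h1 _ _]] := jordan_pair_Eseq T.
have /= := jordan_pair_Eseq (inv_seq T).
rewrite map_inv_seq !Eseq_inv_seqK => -[[h2 _ _ _] [h3 _ _ _]]; split=> //.
by apply: oppr_inj; rewrite -jordanN -!mulrN h3.
Qed.

(* The reverse-order product [N 0 0 * M 0 1] of entries of [M] and [M^-1] is a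
   sum of Jordan monomials, although [M 0 1] itself is not. *)
Lemma jordan_Eseq_corner T :
  f (Eseq (inv_seq T) 0 0 * Eseq T 0 1) =
  Eseq (inv_seq (map f T)) 0 0 * Eseq (map f T) 0 1.
Proof.
have NM (A : nzRingType) (S : seq A) :
    Eseq (inv_seq S) 0 1 * Eseq S 1 1 = - (Eseq (inv_seq S) 0 0 * Eseq S 0 1).
  by apply/eqP; rewrite -addr_eq0 addrC -mulmx2E Eseq_invl mxE.
elim: T => [|t T IH]; first by rewrite /= !mxE !mulr0 jordan0.
have [_ _ h] := jordan_Eseq_sandwich T t.
(* The product for [t :: T] is [N 0 1 * t * M 0 1 + N 0 1 * M 1 1]: a sandwich, and by [NM] the
   negative of the product for [T]. *)
rewrite map_cons !Eseq_inv_cons /=.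
rewrite !(Emat_mulE _ _ _).1 !(mul_EinvE _ _ _).1.
by rewrite !mulrDr !mulrA !NM fD h jordanN IH.
Qed.

Lemma pt_Eseq_stable T :
  pt (rv 1 0 *m Eseq T) = pt (rv 1 0) ->
  pt (rv 1 0 *m Eseq (map f T)) = pt (rv 1 0).
Proof.
move=> hpt; have [u [s [x [y [b [hu [us su] hw yb yb']]]]]] :=
  basis2_pt_eq (basis2_rows (Eseq_inv2 T)) (@basis2_rv R) hpt.
move: hu; rewrite rv10_mulmx rvZ mulr1 mulr0 => /rv_inj[m00 m01].
move: hw; rewrite rv01_mulmx -rv_span => /rv_inj[_ m11].
have n00 : Eseq (inv_seq T) 0 0 = s.
  have := mulmx2E (Eseq T) (Eseq (inv_seq T)) 0 0.
  rewrite Eseq_invr mxE eqxx mulr1n m00 m01 mul0r addr0 => h.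
  by rewrite -[LHS]mul1r -su -mulrA -h mulr1.
(* Here [M 1 1 = y] and [N 0 0 = s], so [b * u] and [u * b] make the two sandwiches equal to 1;
   their images give [N' 0 0] a left and a right inverse. *)
have [/= h1 _ _] := jordan_Eseq_sandwich T (b * u).
have [/= _ h2 _] := jordan_Eseq_sandwich T (u * b).
have := jordan_Eseq_corner T.
move: h1 h2; rewrite m11 n00 m01 mulr0 jordan0.
rewrite !mulrA yb mul1r us su mul1r yb' f1.
have := mulmx2E (Eseq (map f T)) (Eseq (inv_seq (map f T))) 0 0.
rewrite Eseq_invr mxE eqxx mulr1n rv10_mulmx.
move: (Eseq (inv_seq _)) (Eseq _) => N M h0 h1 h2 h3.
have M01 : M 0 1 = 0.
  by rewrite -[LHS]mul1r h1 -mulrA -h3 mulr0.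
move: h0; rewrite M01 mul0r addr0 => /esym h0.
have e : M 0 0 = f (u * b) * M 1 1.
  by rewrite -[RHS]mul1r -{1}h0 -!mulrA (mulrA (N 0 0)) -h2 mulr1.
have -> : rv (M 0 0) 0 = M 0 0 *: rv 1 0 by rewrite rvZ mulr1 mulr0.
by rewrite (@pt_unit _ _ (N 0 0)) // e mulrA -h2.
Qed.

(** The stabilizer case, applied to [S ++ inv_seq T]. *)
Lemma pt_Eseq_wd S T :
  pt (rv 1 0 *m Eseq S) = pt (rv 1 0 *m Eseq T) ->
  pt (rv 1 0 *m Eseq (map f S)) = pt (rv 1 0 *m Eseq (map f T)).
Proof.
move=> /(pt_mulmx (Eseq (inv_seq T))).
rewrite -!mulmxA -Eseq_cat Eseq_invr mulmx1 => /pt_Eseq_stable.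
rewrite map_cat map_inv_seq Eseq_cat => /(pt_mulmx (Eseq (map f T))).
by rewrite -!mulmxA Eseq_invl mulmx1.
Qed.

End JordanHomomorphisms.

(** * Linear algebra over a subfield and chains through [R(1,0)] and [R(0,1)] *)

Section Subfields.
Variables (R : nzRingType) (K : R -> Prop) (sK : subfield K).
Implicit Types (a b c d k l : R) (v : 'rV[R]_2) (M : 'M[R]_2).

Let KB a b : K a -> K b -> K (a - b). Proof. by case: sK => _ _ h _ _; apply: h. Qed.
Let KM a b : K a -> K b -> K (a * b). Proof. by case: sK => _ _ _ h _; apply: h. Qed.
Let KV a : K a -> a != 0 -> exists2 b, K b & a * b = 1 /\ b * a = 1.
Proof. by move=> Ka /eqP nza; case: sK => _ _ _ _; apply. Qed.

Lemma subfield_span a b c d k1 k2 : K a -> K b -> K c -> K d -> K k1 -> K k2 ->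
  (a, b) <> (0, 0) -> (forall l, K l -> rv c d <> l *: rv a b) ->
  exists l1 l2, [/\ K l1, K l2 & rv k1 k2 = l1 *: rv a b + l2 *: rv c d].
Proof.
move=> Ka Kb Kc Kd Kk1 Kk2 nz ind; have [a0|nza] := eqVneq a 0.
  have nzb : b != 0 by apply/eqP=> b0; apply: nz; rewrite a0 b0.
  have [b1 Kb1 [bb1 b1b]] := KV Kb nzb.
  have nzc : c != 0.
    apply/eqP=> c0; apply: (ind (d * b1)); first exact: KM.
    by rewrite rvZ a0 c0 mulr0 -mulrA b1b mulr1.
  have [c1 Kc1 [cc1 c1c]] := KV Kc nzc.
  exists ((k2 - k1 * c1 * d) * b1), (k1 * c1); split; [|exact: KM|].
    by apply: KM => //; apply: KB => //; apply: KM => //; apply: KM.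
  rewrite !rvZ rvD a0 mulr0 add0r -mulrA c1c mulr1.
  by rewrite -(mulrA _ b1) b1b mulr1 subrK.
have [a1 Ka1 [aa1 a1a]] := KV Ka nza.
(* This Schur complement replaces the determinant; if it vanished, [(c, d)] would be [c * a1] times
   [(a, b)]. *)
have nze : d - c * a1 * b != 0.
  apply/eqP=> /subr0_eq de; apply: (ind (c * a1)); first exact: KM.
  by rewrite rvZ -de -mulrA a1a mulr1.
have Ke : K (d - c * a1 * b) by apply: KB => //; do !apply: KM.
have [e1 Ke1 [ee1 e1e]] := KV Ke nze.
pose l2 := (k2 - k1 * a1 * b) * e1.
have Kl2 : K l2 by apply: KM => //; apply: KB => //; do !apply: KM.
exists ((k1 - l2 * c) * a1), l2; split=> //.
  by apply: KM => //; apply: KB => //; apply: KM.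
rewrite !rvZ rvD -(mulrA _ a1) a1a mulr1 subrK; congr rv.
have e : l2 * (d - c * a1 * b) = k2 - k1 * a1 * b by rewrite /l2 -(mulrA _ e1) e1e mulr1.
rewrite -[LHS](subrK (k1 * a1 * b)) -e mulrBr !mulrBl !mulrA.
by rewrite [LHS]addrC [LHS]addrA [LHS]addrAC.
Qed.

(** Generators of one cyclic module need not differ by a unit. Here [r * u = 1] follows from the
    condition on [v], and [u * r = 1] by cancelling a nonzero entry of [(a, b)]. *)
Lemma pt_subfield_row a b M v : inv2 M -> K a -> K b -> (a, b) <> (0, 0) ->
  (forall s, s *: v = v -> s = 1) -> pt v = pt (rv a b *m M) ->
  exists u r, [/\ rv a b *m M = u *: v, u * r = 1 & r * u = 1].
Proof.
move=> [N [MN _]] Ka Kb nz hv hpt.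
have [r hr] := pt_eq_scale hpt; have [u hu] := pt_eq_scale (esym hpt).
exists u, r; split=> //; last by apply: hv; rewrite -scalerA -hu -hr.
have /rv_inj[ha hb] : rv (u * r * a) (u * r * b) = rv a b.
  have := congr1 (fun x => x *m N) (esym hu).
  by rewrite {1}hr -!scalemxAl -!mulmxA MN mulmx1 scalerA rvZ.
have [a0|/(KV Ka)[a1 _ [aa1 _]]] := eqVneq a 0; last first.
  by rewrite -[LHS]mulr1 -aa1 mulrA ha.
have [b0|/(KV Kb)[b1 _ [bb1 _]]] := eqVneq b 0; last first.
  by rewrite -[LHS]mulr1 -bb1 mulrA hb.
by case: nz; rewrite a0 b0.
Qed.

(** With [(a,b) M = u (1,0)] and [(c,d) M = w (0,1)], the row [l1 (a,b) + l2 (c,d)] goes to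
    [(l1 u, l2 w)], whence [t = u^-1 (l1^-1 l2) w]. *)
Lemma chain_normal_form M : inv2 M ->
  forall a b c d, K a -> K b -> (a, b) <> (0, 0) -> pt (rv 1 0) = pt (rv a b *m M) ->
    K c -> K d -> (c, d) <> (0, 0) -> pt (rv 0 1) = pt (rv c d *m M) ->
  exists u r w, [/\ u * r = 1, r * u = 1 &
    forall k1 k2 t, K k1 -> K k2 -> pt (rv 1 t) = pt (rv k1 k2 *m M) ->
      exists2 m, K m & t = r * m * w].
Proof.
move=> iM a b c d Ka Kb nzab hab Kc Kd nzcd hcd.
have [|u [r [hu ur ru]]] := pt_subfield_row iM Ka Kb nzab _ hab.
  by move=> s; rewrite rvZ => /rv_inj[]; rewrite mulr1.
have [|w [r' [hw wr rw]]] := pt_subfield_row iM Kc Kd nzcd _ hcd.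
  by move=> s; rewrite rvZ => /rv_inj[_]; rewrite mulr1.
exists u, r, w; split=> // k1 k2 t Kk1 Kk2 ht.
have [l1 [l2 [Kl1 Kl2 hk]]] : exists l1 l2,
    [/\ K l1, K l2 & rv k1 k2 = l1 *: rv a b + l2 *: rv c d].
  apply: subfield_span => // l Kl hl; move: hw.
  rewrite hl -scalemxAl hu !rvZ => /rv_inj[_]; rewrite !mulr0 mulr1 => w0.
  by move: wr; rewrite -w0 mul0r => /esym/eqP; rewrite oner_eq0.
have [q hq] := pt_eq_scale ht; have [q' hq'] := pt_eq_scale (esym ht).
have qq' : q * q' = 1.
  by move: hq; rewrite hq' scalerA rvZ => /rv_inj[/esym]; rewrite mulr1.
move: hq'; rewrite hk mulmxDl -!scalemxAl hu hw !rvZ rvD.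
move=> /rv_inj[]; rewrite !mulr0 !mulr1 addr0 add0r => e1 e2.
have nzl1 : l1 != 0.
  apply/eqP=> l0; move: qq'; rewrite -e1 l0 mul0r mulr0 => /esym/eqP.
  by rewrite oner_eq0.
have [l3 Kl3 [_ l31]] := KV Kl1 nzl1.
exists (l3 * l2); first exact: KM.
rewrite -!mulrA e2 -e1 -(mulrA l1) (mulrA l3) l31 mul1r mulrA ru.
by rewrite mul1r.
Qed.

End Subfields.

(** * The two implications between chain preservation and the unit condition *)

Section Chains.
Variables (R R' : nzRingType) (K : R -> Prop) (K' : R' -> Prop) (f : R -> R').
Variables (sK : subfield K) (sK' : subfield K') (jf : jordan_hom f).

Lemma chain_map_unit_condition (c : R) : is_unit c ->
  (forall G : point R -> Prop, Kchain K G -> (forall p, G p -> Ccomp p) ->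
      exists G' : point R' -> Prop, Kchain K' G' /\
        forall T : seq R, G (pt (rv 1 0 *m Eseq T)) ->
          G' (pt (rv 1 0 *m Eseq (map f T)))) ->
  exists u' v' : R', u' * v' = 1 /\ v' * u' = 1 /\
    forall k : R, K k -> exists2 k' : R', K' k' & f (k * c) = v' * k' * u' * f c.
Proof.
move=> [d [cd dc]] hyp.
have [K0 K1 _ _ KV] := sK; have [_ _ _ KM' KV'] := sK'; have [_ f1 _] := jf.
have one_neq0 (A : nzRingType) : (1 : A) <> 0 by apply/eqP; rewrite oner_eq0.
pose D := mx_rows (rv 1 0) (rv 0 c).
have rvD a b : rv a b *m D = rv a (b * c).
  by rewrite rv_mulmx rv10_mx_rows rv01_mx_rows !rvZ rvD !mulr0 mulr1 addr0 add0r.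
pose G (p : point R) :=
  exists a b : R, [/\ K a, K b, (a, b) <> (0, 0) & p = pt (rv a b *m D)].
have [|p|G' [[M [iM hG']] hT]] := hyp G.
- exists D; split=> //; by apply: (@inv2_trig _ 1 1 0 c d); rewrite ?mulr1.
- move=> [a [b [Ka Kb nz ->]]]; rewrite rvD.
  have [a0|/eqP nza] := eqVneq a 0.
    have nzb : b <> 0 by move=> b0; apply: nz; rewrite a0 b0.
    have [b1 _ [_ b1b]] := KV b Kb nzb.
    have -> : rv a (b * c) = (b * c) *: rv 0 1 by rewrite rvZ a0 mulr0 mulr1.
    rewrite (@pt_unit _ _ (d * b1)); first exact: Ccomp_01.
    by rewrite -mulrA (mulrA b1) b1b mul1r.
  have [a1 _ [aa1 a1a]] := KV a Ka nza.
  have -> : rv a (b * c) = a *: rv 1 (a1 * (b * c)).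
    by rewrite rvZ mulr1 mulrA aa1 mul1r.
  by rewrite (pt_unit _ a1a); apply: Ccomp_1.
have Gk k : K k -> G' (pt (rv 1 (f (k * c)))).
  move=> Kk; rewrite pt_1_Eseq.
  have -> : [:: - f (k * c); 0] = map f [:: - (k * c); 0].
    by rewrite /= (jordanN jf) (jordan0 jf).
  apply: hT; rewrite -pt_1_Eseq.
  by exists 1, k; split=> //; [case=> /one_neq0|rewrite rvD].
have /hG'[a [b [Ka Kb nzab hab]]] : G' (pt (rv 1 0)).
  by have := Gk 0 K0; rewrite mul0r (jordan0 jf).
have /hG'[a' [b' [Ka' Kb' nzab' hab']]] : G' (pt (rv 0 1)).
  have e : [:: 0] = map f [:: 0] by rewrite /= (jordan0 jf).
  rewrite pt_0_Eseq e; apply: hT; rewrite -pt_0_Eseq.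
  exists 0, 1; split=> //; first by case=> /one_neq0.
  rewrite rvD mul1r -(@pt_unit _ c d) //.
  by rewrite rvZ mulr0 mulr1.
have [u [r [w [ur ru nf]]]] :=
  chain_normal_form sK' iM Ka Kb nzab hab Ka' Kb' nzab' hab'.
have {}nf k : K k -> exists2 m, K' m & f (k * c) = r * m * w.
  by move=> /Gk/hG'[k1 [k2 [h1 h2 _ /(nf _ _ _ h1 h2)]]].
(* The case [k = 1] eliminates [w]: it gives [w = m0^-1 * u * f c], and [m0] is nonzero because
   [f c] is a unit. *)
have [m0 Km0] := nf 1 K1; rewrite mul1r => hc.
have [fcd fdc] := jordan_inv jf cd dc.
have nzm0 : m0 <> 0.
  by move=> m00; move: fcd; rewrite hc m00 mulr0 !mul0r => /esym/one_neq0.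
have [m1 Km1 [_ m1m]] := KV' m0 Km0 nzm0.
exists u, r; split=> //; split=> // k /nf[m Km ->].
exists (m * m1); first exact: KM'.
by rewrite hc -!mulrA (mulrA u) ur mul1r (mulrA m1) m1m mul1r.
Qed.

Lemma unit_condition_chain_map (G : point R -> Prop) :
  (forall c : R, is_unit c ->
      exists u' v' : R', u' * v' = 1 /\ v' * u' = 1 /\
        forall k : R, K k -> exists2 k' : R', K' k' & f (k * c) = v' * k' * u' * f c) ->
  Kchain K G -> (forall p, G p -> Ccomp p) ->
  exists G' : point R' -> Prop, Kchain K' G' /\
    forall T : seq R, G (pt (rv 1 0 *m Eseq T)) ->
      G' (pt (rv 1 0 *m Eseq (map f T))).
Proof.
move=> hyp [M [iM hG]] hC.
have [K0 K1 _ KM KV] := sK; have [K0' K1' _ _ _] := sK'; have [fD _ fU] := jf.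
have one_neq0 (A : nzRingType) : (1 : A) <> 0 by apply/eqP; rewrite oner_eq0.
have /hC/Ccomp_Eseq[T0 hT0] : G (pt (rv 1 0 *m M)).
  by apply/hG; exists 1, 0; split=> // -[/one_neq0].
have [u [s [x [y [b [hr0 [us su] hr1 yb yb']]]]]] :=
  basis2_pt_eq (basis2_rows iM) (basis2_rows (Eseq_inv2 T0)) hT0.
have cuy : u * y * (b * s) = 1 by rewrite -mulrA (mulrA y) yb mul1r.
have cuy' : b * s * (u * y) = 1 by rewrite -mulrA (mulrA s) su mul1r.
have [u' [v' [uv [vu hk]]]] : exists u' v' : R', u' * v' = 1 /\ v' * u' = 1 /\
    forall k, K k -> exists2 k', K' k' & f (k * (u * y)) = v' * k' * u' * f (u * y).
  by apply: hyp; exists (b * s).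
have [fyb fby] := jordan_inv jf yb yb'; have [fc fc'] := jordan_inv jf cuy cuy'.
(* Chosen so that [f (b * (k * (u * y)) * b)] becomes [W * k' * V]. Scaling by [W1 = W^-1] then
   turns the image point into row [(k', 1)] of the chain of [M']. *)
pose W := f b * v'; pose W1 := u' * f y.
pose V := u' * f (u * y) * f b; pose V1 := f y * f (b * s) * v'.
have WW1 : W * W1 = 1 by rewrite /W /W1 -mulrA (mulrA v') vu mul1r.
have W1W : W1 * W = 1 by rewrite /W /W1 -mulrA (mulrA (f y)) fyb mul1r.
have VV1 : V * V1 = 1.
  by rewrite /V /V1 -!mulrA (mulrA (f b)) fby mul1r (mulrA (f _)) fc mul1r.
have V1V : V1 * V = 1.
  by rewrite /V /V1 -!mulrA (mulrA v') vu mul1r (mulrA (f _) (f (u * y))) fc' mul1r.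
pose L := mx_rows (rv V 0) (rv (W1 * f (b * x)) W1).
pose M' := L *m Eseq (map f T0).
have rvM' k1 k2 : rv k1 k2 *m M' =
    (k1 * V + k2 * (W1 * f (b * x))) *: (rv 1 0 *m Eseq (map f T0))
    + (k2 * W1) *: (rv 0 1 *m Eseq (map f T0)).
  rewrite mulmxA [rv k1 k2 *m L]rv_mulmx rv10_mx_rows rv01_mx_rows !rvZ rvD.
  by rewrite mulr0 add0r rv_mulmx.
exists (fun p => exists a b : R',
  [/\ K' a, K' b, (a, b) <> (0, 0) & p = pt (rv a b *m M')]); split.
  exists M'; split=> //; apply: inv2_mulmx; last exact: Eseq_inv2.
  exact: inv2_trig VV1 V1V W1W WW1.
move=> T /hG[a0 [b0 [Ka0 Kb0 nz hT]]].
move: hT; rewrite (rv_mulmx a0 b0) hr0 hr1 scalerDr !scalerA addrA -scalerDl.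
(* For [b0 = 0] the point is [R(1,0) E(T0)] itself; otherwise it has the form
   [R(1,0) E(t) E(T0)]. *)
have [b00|/eqP nzb0] := eqVneq b0 0.
  have nza0 : a0 <> 0 by move=> a00; apply: nz; rewrite a00 b00.
  have [a1 _ [_ a1a]] := KV a0 Ka0 nza0.
  rewrite b00 !mul0r scale0r !addr0 (@pt_unit _ _ (s * a1)); last first.
    by rewrite -mulrA (mulrA a1) a1a mul1r.
  move=> /(pt_Eseq_wd jf) ->; exists 1, 0; split=> //; first by case=> /one_neq0.
  by rewrite rvM' !mul0r scale0r !addr0 mul1r (pt_unit _ V1V).
have [b1 Kb1 [bb1 b1b]] := KV b0 Kb0 nzb0; pose k := b1 * a0.
(* This is [y^-1 * (k * u + x)], with [u] written as [u * y * b] to expose a Jordan product. *)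
pose t := b * (k * (u * y)) * b + b * x.
have -> : (a0 * u + b0 * x) *: (rv 1 0 *m Eseq T0) + (b0 * y) *: (rv 0 1 *m Eseq T0)
    = (b0 * y) *: (rv 1 0 *m Eseq (t :: T0)).
  rewrite rv10_Eseq_cons scalerDr scalerA; congr (_ *: _ + _).
  have et : y * t = k * u + x by rewrite /t mulrDr !mulrA yb !mul1r -(mulrA _ y b) yb mulr1.
  by rewrite -mulrA et mulrDr !mulrA bb1 mul1r.
rewrite (@pt_unit _ _ (b * b1)); last by rewrite -mulrA (mulrA b1) b1b mul1r.
have [k' Kk' hk'] := hk k (KM _ _ Kb1 Ka0).
move=> /(pt_Eseq_wd jf) ->; exists k', 1; split=> //; first by case=> _ /one_neq0.
rewrite map_cons rv10_Eseq_cons rvM' !mul1r -(@pt_unit _ W1 W) //; congr pt.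
rewrite scalerDr scalerA; congr (_ *: _ + _).
rewrite /t fD fU hk' mulrDr; congr (_ + _).
rewrite /V /W1 -!mulrA; rewrite (mulrA (f y)) fyb mul1r.
by rewrite (mulrA u') uv mul1r.
Qed.

End Chains.

(** The induced map is expressed on sequences: [Ccomp_Eseq] provides one for every point of [C], and
    by [pt_Eseq_wd] the image does not depend on it. *)
Theorem theorem5p2 (R R' : nzRingType) (K : R -> Prop) (K' : R' -> Prop)
    (alpha : R -> R') :
  subfield K -> subfield K' -> jordan_hom alpha ->
  ((forall G : point R -> Prop, Kchain K G -> (forall p, G p -> Ccomp p) ->
      exists G' : point R' -> Prop, Kchain K' G' /\
        forall T : seq R, G (pt (rv 1 0 *m Eseq T)) ->
          G' (pt (rv 1 0 *m Eseq (map alpha T))))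
   <->
   (forall c : R, is_unit c ->
      exists u' v' : R', u' * v' = 1 /\ v' * u' = 1 /\
        forall k : R, K k -> exists2 k' : R', K' k' & alpha (k * c) = v' * k' * u' * alpha c)).
Proof.
move=> sK sK' ja; split=> hyp.
  by move=> c uc; apply: chain_map_unit_condition.
by move=> G; apply: unit_condition_chain_map.
Qed.
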